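(* Let $L$ be an Archimedean truncated vector lattice, with truncation denoted by $f\mapsto f^{\ast}$. Then there exist a locally compact Hausdorff space $\mathcal{X}$ and a lattice isomorphism of $L$ onto a vector sublattice of $C^{\infty}(\mathcal{X})$ such that, upon identifying $L$ with its image under this isomorphism: (i) $L$ is a vector sublattice of $C^{\infty}(\mathcal{X})$; (ii) $L$ separates points from closed sets in $\mathcal{X}$; (iii) there exists an open-closed set $\mathcal{Y}$ in $\mathcal{X}$ such that $f^{\ast}=1_{\mathcal{Y}}\wedge f$ for all $f\in L^{+}$; (iv) $L$ vanishes nowhere on $\mathcal{X}$, i.e., for every $x\in\mathcal{X}$ there exists $f\in L$ such that $f(x)\neq 0$; (v) for all $f\in L$ and $\varepsilon\in(0,\infty)$, the set $\{y\in\mathcal{Y}:|f(y)|\geq\varepsilon\}$ is compact, where $\mathcal{Y}$ is the set in (iii).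
   Context: All vector lattices are real; $L^{+}$ is the positive cone of $L$. $L$ is Archimedean if $f,g\in L^{+}$ and $nf\leq g$ for all $n\in\{1,2,\dots\}$ imply $f=0$. A truncation on $L$ is a nonzero function (not identically zero) $L^{+}\to L^{+}$, $f\mapsto f^{\ast}$, such that (a) $f\wedge g^{\ast}\leq f^{\ast}\leq f$ for all $f,g\in L^{+}$; and (b) if $f\in L^{+}$ and $(nf)^{\ast}=nf$ for all $n\in\{1,2,\dots\}$, then $f=0$. A truncated vector lattice is a vector lattice along with a truncation. $\overline{\mathbb{R}}=[-\infty,\infty]$ is the two-point compactification of $\mathbb{R}$. For a topological space $X$, $C^{\infty}(X)$ is the set of all continuous $\varphi:X\to\overline{\mathbb{R}}$ such that $\{x\in X:|\varphi(x)|\neq\infty\}$ is dense in $X$; it is a lattice under the pointwise ordering and is closed under multiplication by real scalars. For $\varphi,\psi,\chi\in C^{\infty}(X)$, $\chi=\varphi+\psi$ means that $\chi(x)=\varphi(x)+\psi(x)$ at every $x$ where $\varphi(x)$ and $\psi(x)$ are both finite (this determines $\chi$, if it exists). A vector sublattice of $C^{\infty}(X)$ is a sublattice closed under addition (in this sense, sums of its members exist and belong to it) and under scalar multiplication. $1_{\mathcal{Y}}$ denotes the characteristic function of $\mathcal{Y}$, and $\wedge$ of functions is the pointwise minimum. A set $L$ of functions separates points from closed sets in $\mathcal{X}$ if for every closed $\mathcal{F}\subset\mathcal{X}$ and every $x\in\mathcal{X}\setminus\mathcal{F}$ there exists $f\in L^{+}$ with $f(x)=1$ and $f(y)=0$ for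 all $y\in\mathcal{F}$. *)

(* Defs.v *)
From HB Require Import structures.
From mathcomp Require Import all_boot all_order all_algebra.
From mathcomp Require Import all_classical all_reals all_analysis.

Set Implicit Arguments.
Unset Strict Implicit.
Unset Printing Implicit Defensive.

Import Order.TTheory GRing.Theory Num.Theory.
Import numFieldNormedType.Exports.

Local Open Scope classical_set_scope.
Local Open Scope ring_scope.

(* Real vector lattices (Riesz spaces): ordered vector spaces in which any two
   elements have an infimum and a supremum.  Order.Lattice and GRing.Lmodule
   cannot be joined downstream of MathComp (there is no common structure below
   this join and Num.RealDomain), so the lattice operations are fields here,
   characterized as in Order.Lattice by lexI and leUx. *)
HB.mixin Record POrderedZmodule_isVectorLattice (R : realType) L
    of GRing.Lmodule R L & Num.POrderedZmodule L := {
  vmeet : L -> L -> L ;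
  vjoin : L -> L -> L ;
  le_vmeet : forall u v w : L, (u <= vmeet v w) = (u <= v) && (u <= w) ;
  vjoin_le : forall u v w : L, (vjoin u v <= w) = (u <= w) && (v <= w) ;
  lev_add2r : forall u v w : L, u <= v -> u + w <= v + w ;
  lev_scale2l : forall (a : R) (u v : L), 0 <= a -> u <= v -> a *: u <= a *: v
}.

#[short(type="vectorLatticeType")]
HB.structure Definition VectorLattice (R : realType) :=
  { L of GRing.Lmodule R L & Num.POrderedZmodule L
       & POrderedZmodule_isVectorLattice R L }.

Section Truncation.
Variables (R : realType) (L : vectorLatticeType R).

Definition archimedean_lattice :=
  forall f g : L, 0 <= f -> 0 <= g ->
    (forall n : nat, (0 < n)%N -> f *+ n <= g) -> f = 0.

(* A truncation is a function on the positive cone; it is represented by a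
   function on L whose values outside the cone are unconstrained and unused. *)
Record truncation (star : L -> L) : Prop := {
  trunc_ge0 : forall f, 0 <= f -> 0 <= star f ;
  trunc_nonzero : exists2 f, 0 <= f & star f <> 0 ;
  trunc_bounds : forall f g, 0 <= f -> 0 <= g ->
    vmeet f (star g) <= star f /\ star f <= f ;
  trunc_bounded : forall f, 0 <= f ->
    (forall n : nat, (0 < n)%N -> star (f *+ n) = f *+ n) -> f = 0
}.

End Truncation.

Section ExtendedContinuousFunctions.
Variables (R : realType) (X : topologicalType).
Implicit Types (phi psi chi : X -> \bar R) (A : set (X -> \bar R)).

Definition Cinfty : set (X -> \bar R) :=
  [set phi | continuous phi /\ dense [set x | `|phi x|%E != +oo%E]].

(* chi = phi + psi, required only where both summands are finite *)
Definition Cinfty_sum phi psi chi :=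
  forall x, phi x \is a fin_num -> psi x \is a fin_num ->
    chi x = (phi x + psi x)%E.

(* The extended-real product satisfies 0 * (+oo) = 0 * (-oo) = 0, so that
   Cinfty_scale 0 phi is the zero function for every phi. *)
Definition Cinfty_scale (a : R) phi : X -> \bar R := fun x => (a%:E * phi x)%E.

Definition Cinfty_meet phi psi : X -> \bar R :=
  fun x => Order.min (phi x) (psi x).

Definition Cinfty_join phi psi : X -> \bar R :=
  fun x => Order.max (phi x) (psi x).

Record vector_sublattice A : Prop := {
  vsl_sub : A `<=` Cinfty ;
  vsl_meet : forall phi psi, A phi -> A psi -> A (Cinfty_meet phi psi) ;
  vsl_join : forall phi psi, A phi -> A psi -> A (Cinfty_join phi psi) ;
  vsl_sum : forall phi psi, A phi -> A psi ->
    exists2 chi, A chi & Cinfty_sum phi psi chi ;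
  vsl_scale : forall a phi, A phi -> A (Cinfty_scale a phi)
}.

Definition separates_points_from_closed_sets A :=
  forall (F : set X) (x : X), closed F -> ~ F x ->
    exists phi, [/\ A phi, forall y, (0 <= phi y)%E, phi x = 1%E
                  & forall y, F y -> phi y = 0%E].

Definition vanishes_nowhere A := forall x, exists2 phi, A phi & phi x <> 0%E.

(* isomorphism, both as lattices and as vector spaces, of L onto A *)
Record vector_lattice_isomorphism (L : vectorLatticeType R)
    (T : L -> X -> \bar R) A : Prop := {
  vli_bij : set_bij [set: L] A T ;
  vli_meet : forall f g, T (vmeet f g) = Cinfty_meet (T f) (T g) ;
  vli_join : forall f g, T (vjoin f g) = Cinfty_join (T f) (T g) ;
  vli_sum : forall f g, Cinfty_sum (T f) (T g) (T (f + g)) ;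
  vli_scale : forall a f, T (a *: f) = Cinfty_scale a (T f)
}.

End ExtendedContinuousFunctions.

(* Main.v *)
Require Import Defs.
From mathcomp Require Import all_boot all_order all_algebra.
From mathcomp Require Import all_classical all_reals all_analysis.
From mathcomp Require Import lra.
Import Order.TTheory GRing.Theory Num.Theory.
Import numFieldNormedType.Exports.
Local Open Scope classical_set_scope.
Local Open Scope ring_scope.

Set Implicit Arguments.
Unset Strict Implicit.
Unset Printing Implicit Defensive.

(** Points of the space are maps [x : L -> \bar R] that respect the lattice
    operations, scalar multiplication, and addition wherever one summand is
    finite ([ext_hom]), that do not vanish identically, and that are normalized
    by some truncation [t] out of a family [F], meaning that
    [x (t f) = min 1 (x f)] for all [f >= 0].  The family [F] contains [star],
    its members are pairwise disjoint ([t f /\ t' g = 0]), and every [f > 0]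
    has [t f <> 0] for some [t] in [F].  Such a family exists by Zorn: if all
    members of a disjoint family kill [f > 0], the truncation [g |-> g /\ f]
    may be added, [L] being Archimedean ([truncation_family_exists]).
    An element [f] of [L] acts on the space by evaluation [x |-> x f], and the
    topology is the coarsest one that makes all evaluations continuous.  So
    evaluation is a homomorphism by construction, each [t] in [F] has its own
    clopen piece of the space, on which [t f] is [min 1 f] and outside which
    [t f] is [0], and [Y] is the piece of [star].

    Points exist in sufficient number ([point_exists]).  Given [t h <> 0], a
    suitable multiple [k] of [t h] has [t k <> k], since no nonzero element has
    all its multiples fixed by [t].  Choose a maximal filter of positive
    elements, closed under meets, that contains [k - t k]; the elements disjoint
    from some member of it are null, and two disjoint elements cannot both fail
    to be null.  Hence the order modulo null elements is total, and [t] becomes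
    [f |-> f /\ t k] modulo null elements because [(t f - t k)^+] is disjoint
    from [k - t k].  Reading off the size of each [f] relative to the unit
    [t k] as a Dedekind cut gives a point, which is positive at [h].

    All the defining conditions of a point pass to limits of ultrafilters, and
    [\bar R] is compact.  Only the zero map can be lost in a limit, and a bound
    [e <= |x f|] prevents that; this gives the compactness claim
    ([piece_compact]) and local compactness.

    Constants need not lie in [L], but near each point some [p] in [L] is
    constantly [1] ([plateau]).  Cutting off [(g - r p)^+] and [(r p - g)^+] by
    such a plateau yields functions in [L] with supports in a basis of
    neighbourhoods ([separation]).  Finally, if [|f|] were infinite on a
    nonempty open set, a separating [h] supported there would satisfy
    [n h <= |f|] for all [n], against the Archimedean property; so every [f] is
    finite on a dense set ([finite_dense]), and injectivity follows. *)

(** * Vector lattices *)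

Section VectorLattice.
Variables (R : realType) (L : vectorLatticeType R).
Implicit Types (u v w f g h : L) (a b : R).

Lemma levD2r w u v : (u + w <= v + w) = (u <= v).
Proof.
apply/idP/idP => [/(@lev_add2r _ _ _ _ (- w))|]; last exact: lev_add2r.
by rewrite !addrK.
Qed.

Lemma levD u v f g : u <= v -> f <= g -> u + f <= v + g.
Proof.
move=> uv fg; apply: (le_trans (lev_add2r _ _ f uv)).
by rewrite ![v + _]addrC levD2r.
Qed.

Lemma subv_ge0 u v : (0 <= v - u) = (u <= v).
Proof. by rewrite -[LHS](levD2r u) subrK add0r. Qed.

Lemma levBlDr u v w : (u - w <= v) = (u <= v + w).
Proof. by rewrite -[LHS](levD2r w) subrK. Qed.

Lemma levN2 u v : (- u <= - v) = (v <= u).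
Proof. by rewrite -[LHS]subv_ge0 opprK addrC subv_ge0. Qed.

Lemma mulrvn_ge0 u n : 0 <= u -> 0 <= u *+ n.
Proof.
move=> u0; elim: n => [|n IH]; first by rewrite mulr0n.
by rewrite mulrS -[0]addr0 levD.
Qed.

Lemma scalev_ge0 a u : 0 <= a -> 0 <= u -> 0 <= a *: u.
Proof. by move=> a0 u0; rewrite -(scaler0 L a) lev_scale2l. Qed.

Lemma lev_wscale a b u : 0 <= u -> a <= b -> a *: u <= b *: u.
Proof. by move=> u0 ab; rewrite -subv_ge0 -scalerBl scalev_ge0// subr_ge0. Qed.

Lemma vmeetl u v : vmeet u v <= u.
Proof. by have := lexx (vmeet u v); rewrite le_vmeet => /andP[]. Qed.

Lemma vmeetr u v : vmeet u v <= v.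
Proof. by have := lexx (vmeet u v); rewrite le_vmeet => /andP[]. Qed.

Lemma vmeetC u v : vmeet u v = vmeet v u.
Proof. by apply/eqP; rewrite eq_le !le_vmeet !vmeetl !vmeetr. Qed.

Lemma vmeet_l u v : u <= v -> vmeet u v = u.
Proof. by move=> uv; apply/eqP; rewrite eq_le vmeetl le_vmeet lexx. Qed.

Lemma vmeet_ge0 u v : 0 <= u -> 0 <= v -> 0 <= vmeet u v.
Proof. by rewrite le_vmeet => -> ->. Qed.

Lemma vmeetS u v f g : u <= v -> f <= g -> vmeet u f <= vmeet v g.
Proof.
move=> uv fg; rewrite le_vmeet (le_trans (vmeetl u f) uv) /=.
exact: le_trans (vmeetr u f) fg.
Qed.

Lemma vmeetDr w u v : vmeet u v + w = vmeet (u + w) (v + w).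
Proof.
apply/eqP; rewrite eq_le le_vmeet !levD2r vmeetl vmeetr /=.
by rewrite -(subrK w (vmeet (u + w) _)) levD2r le_vmeet !levBlDr vmeetl vmeetr.
Qed.

Lemma vjoinl u v : u <= vjoin u v.
Proof. by have := lexx (vjoin u v); rewrite vjoin_le => /andP[]. Qed.

Lemma vjoinr u v : v <= vjoin u v.
Proof. by have := lexx (vjoin u v); rewrite vjoin_le => /andP[]. Qed.

Lemma vjoinE u v : vjoin u v = - vmeet (- u) (- v).
Proof.
apply/eqP; rewrite eq_le vjoin_le -[_ <= vjoin u v]levN2 opprK.
by rewrite le_vmeet !levN2 vjoinl vjoinr -[u <= _]levN2 -[v <= _]levN2 opprK
  vmeetl vmeetr.
Qed.

Definition vpos u := vjoin u 0.

Lemma vpos_ge0 u : 0 <= vpos u. Proof. exact: vjoinr. Qed.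

Lemma vpos_ge u : u <= vpos u. Proof. exact: vjoinl. Qed.

Lemma vpos_leP u v : (vpos u <= v) = (u <= v) && (0 <= v).
Proof. exact: vjoin_le. Qed.

Lemma vpos_eq0 u : u <= 0 -> vpos u = 0.
Proof. by move=> u0; apply/eqP; rewrite eq_le vpos_ge0 vpos_leP u0 lexx. Qed.

(** Subtracting [vpos u /\ vpos (- u)] from [vpos u] leaves an upper bound of
    both [u] and [0]. *)
Lemma vposN_disjoint u : vmeet (vpos u) (vpos (- u)) = 0.
Proof.
set m := vmeet _ _.
apply/eqP; rewrite eq_le vmeet_ge0 ?vpos_ge0// andbT.
have posE : vpos u = u + vpos (- u).
  rewrite /vpos !vjoinE opprK oppr0 -[X in _ = X - _]opprK -opprD; congr (- _).
  by rewrite addrC vmeetDr subrr add0r vmeetC.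
have : vpos u <= vpos u - m.
  rewrite {1}/vpos vjoin_le subv_ge0 vmeetl andbT posE -addrA.
  by rewrite -[leLHS]addr0 levD// subv_ge0 vmeetr.
rewrite -[in X in X -> _]subv_ge0 addrAC subrr add0r.
by rewrite -[X in X <= - m]oppr0 levN2.
Qed.

Lemma vmeet_leD w u v : 0 <= w -> 0 <= u -> 0 <= v ->
  vmeet w (u + v) <= vmeet w u + vmeet w v.
Proof.
move=> w0 u0 v0.
have le_addl x y : 0 <= y -> x <= x + y :> L.
  by move=> y0; rewrite -{1}[x]addr0 levD.
rewrite vmeetDr le_vmeet (le_trans (vmeetl w _)) ?le_addl ?vmeet_ge0//=.
rewrite [u + vmeet _ _]addrC vmeetDr le_vmeet.
rewrite (le_trans (vmeetl w _)) ?le_addl//=.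
by rewrite [v + u]addrC vmeetr.
Qed.

End VectorLattice.

Lemma ereal_between (R : realType) (v w : \bar R) :
  (v < w)%E -> exists r : R, (v < r%:E)%E /\ (r%:E < w)%E.
Proof.
case: v w => [a| |] [b| |]//=; rewrite ?lte_fin => ab.
- by exists ((a + b) / 2); rewrite !lte_fin; split; lra.
- by exists (a + 1); rewrite lte_fin ltry; split => //; lra.
- by exists (b - 1); rewrite lte_fin ltNyr; split => //; lra.
- by exists 0; rewrite ltNyr ltry.
Qed.

(** * Extended-real homomorphisms from total preorders *)

Section ExtendedHomomorphisms.
Variables (R : realType) (L : vectorLatticeType R).
Implicit Types (f g h u d e : L) (a r s : R) (v w : \bar R) (x : L -> \bar R).

(** Finiteness of the second summand alone is required: for [x f] infinite the
    last condition still fixes [x (f + g)].  In this form the conditions are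
    closed under pointwise limits. *)
Record ext_hom x : Prop := {
  ehom_meet : forall f g, x (vmeet f g) = Order.min (x f) (x g) ;
  ehom_scale : forall a f, x (a *: f) = (a%:E * x f)%E ;
  ehom_add : forall f g, x g \is a fin_num -> x (f + g) = (x f + x g)%E
}.

Section Theory.
Variable x : L -> \bar R.
Hypothesis xh : ext_hom x.

Lemma ehom0 : x 0 = 0%E.
Proof. by rewrite -(scale0r 0) (ehom_scale xh) mul0e. Qed.

Lemma ehomN f : x (- f) = (- x f)%E.
Proof. by rewrite -scaleN1r (ehom_scale xh) EFinN mulN1e. Qed.

Lemma ehomB f g : x g \is a fin_num -> x (f - g) = (x f - x g)%E.
Proof. by move=> xg; rewrite (ehom_add xh) ehomN// fin_numN. Qed.

Lemma ehom_join f g : x (vjoin f g) = Order.max (x f) (x g).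
Proof.
by rewrite vjoinE ehomN (ehom_meet xh) !ehomN -oppe_max oppeK.
Qed.

Lemma ehom_le f g : f <= g -> (x f <= x g)%E.
Proof. by move=> fg; rewrite -(vmeet_l fg) (ehom_meet xh) ge_min lexx orbT. Qed.

Lemma ehom_ge0 f : 0 <= f -> (0 <= x f)%E.
Proof. by move=> f0; rewrite -ehom0 ehom_le. Qed.

Lemma ehom_pos f : x (vpos f) = Order.max (x f) 0%E.
Proof. by rewrite ehom_join ehom0. Qed.

End Theory.

(** These are the preorders induced by the quotients of [L] by prime ideals. *)
Record lattice_preorder (Q : L -> L -> Prop) : Prop := {
  lpre_total : forall f g, Q f g \/ Q g f ;
  lpre_trans : forall f g h, Q f g -> Q g h -> Q f h ;
  lpre_le : forall f g, f <= g -> Q f g ;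
  lpre_add : forall f g h, Q f g -> Q (f + h) (g + h) ;
  lpre_scale : forall a f g, 0 <= a -> Q f g -> Q (a *: f) (a *: g) ;
  lpre_meet : forall f g h, Q h f -> Q h g -> Q h (vmeet f g)
}.

Section Cut.
Variables (Q : L -> L -> Prop) (e : L).
Hypotheses (QP : lattice_preorder Q) (e_ge0 : 0 <= e) (e_nz : ~ Q e 0).

(** The extended real [v] is the ratio of [f] to the unit [e].  Both halves of
    the cut are kept, since negation exchanges them. *)
Definition cut f v :=
  (forall r, (r%:E < v)%E -> Q (r *: e) f) /\
  (forall r, (v < r%:E)%E -> Q f (r *: e)).

Lemma cut_exists f : exists v, cut f v.
Proof.
exists (ereal_sup [set r%:E | r in [set r | Q (r *: e) f]]); split => r.
  move=> /ereal_sup_gt[_ [s Qs <-]]; rewrite lte_fin => rs.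
  exact: (lpre_trans QP) (lpre_le QP (lev_wscale e_ge0 (ltW rs))) Qs.
move=> vr; case: (lpre_total QP f (r *: e)) => // Qr; exfalso; move: vr.
by rewrite ltNge ereal_sup_ubound//; exists r.
Qed.

(** Were [w < v], two reals [r < s] strictly between them would give
    [s e <= f <= g <= r e], whence [e <= 0]. *)
Lemma cut_le f g v w : cut f v -> cut g w -> Q f g -> (v <= w)%E.
Proof.
move=> [fv _] [_ gw] fg; rewrite leNgt; apply/negP => wv; apply: e_nz.
have [r [wr rv]] := ereal_between wv.
have [s [rs sv]] := ereal_between rv; move: rs; rewrite lte_fin => rs.
have := lpre_trans QP (lpre_trans QP (fv s sv) fg) (gw r wr).
move=> /(lpre_add QP (- (r *: e))); rewrite subrr -scalerBl.
have sr0 : 0 < s - r by rewrite subr_gt0.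
have sr1 : 0 <= (s - r)^-1 by rewrite invr_ge0 ltW.
by move=> /(lpre_scale QP sr1); rewrite scaler0 scalerA mulVf ?gt_eqF// scale1r.
Qed.

Lemma cut_unique f v w : cut f v -> cut f w -> v = w.
Proof.
move=> fv fw; have ff := lpre_le QP (lexx f).
by apply/eqP; rewrite eq_le (cut_le fv fw ff) (cut_le fw fv ff).
Qed.

Lemma preorder_addK f g h : Q (f + h) (g + h) -> Q f g.
Proof. by move=> /(lpre_add QP (- h)); rewrite !addrK. Qed.

Lemma preorder_addD f g f' g' : Q f g -> Q f' g' -> Q (f + f') (g + g').
Proof.
move=> fg fg'; apply: (lpre_trans QP) (lpre_add QP f' fg) _.
by rewrite ![g + _]addrC; exact: lpre_add.
Qed.

Lemma cut_unit : cut e 1.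
Proof.
split => r; rewrite lte_fin => r1; apply: (lpre_le QP).
  by rewrite -[leRHS]scale1r lev_wscale// ltW.
by rewrite -[leLHS]scale1r lev_wscale// ltW.
Qed.

Lemma cut0 : cut 0 0.
Proof.
split => r; rewrite lte_fin => r1; apply: (lpre_le QP);
by rewrite -(scale0r e) lev_wscale// ltW.
Qed.

Lemma cutN f v : cut f v -> cut (- f) (- v).
Proof.
move=> [fv vf]; split => r rv; apply: (@preorder_addK _ _ (f - r *: e)).
  rewrite addrCA subrr addr0 addKr -scaleNr; apply: vf.
  by rewrite EFinN lteNr.
rewrite addKr addrCA subrr addr0 -scaleNr; apply: fv.
by rewrite EFinN lteNl.
Qed.

Lemma cutZ_gt0 a f v : 0 < a -> cut f v -> cut (a *: f) (a%:E * v).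
Proof.
move=> a0 [fv vf]; have aK r : r *: e = a *: ((a^-1 * r) *: e).
  by rewrite scalerA mulrA divff ?gt_eqF// mul1r.
split => r rv; rewrite aK; apply: (lpre_scale QP) (ltW a0) _.
  by apply: fv; rewrite EFinM lte_pdivrMl.
by apply: vf; rewrite EFinM lte_pdivlMl.
Qed.

Lemma cutZ a f v : cut f v -> cut (a *: f) (a%:E * v).
Proof.
move=> fv; have [a0|a0|->] := ltgtP a 0; last first.
- by rewrite scale0r mul0e; exact: cut0.
- exact: cutZ_gt0.
- rewrite -[a]opprK scaleNr EFinN mulNe; apply/cutN/cutZ_gt0 => //.
  by rewrite oppr_gt0.
Qed.

(** With [w] finite, any [r < v + w] splits as [s + (r - s)] with [s < v] and
    [r - s < w], and likewise from above. *)
Lemma cutD f g v w : w \is a fin_num -> cut f v -> cut g w ->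
  cut (f + g) (v + w).
Proof.
case: w => [w| |]// _ [fv vf] [gw wg]; split => r rv.
  have [s [rs sv]] : exists s, ((r - w)%:E < s%:E)%E /\ (s%:E < v)%E.
    by apply: ereal_between; rewrite EFinB lteBlDr.
  have -> : r *: e = s *: e + (r - s) *: e by rewrite -scalerDl addrC subrK.
  apply: preorder_addD; [exact: fv|apply: gw].
  by move: rs; rewrite !lte_fin; lra.
have [s [rs sv]] : exists s, (v < s%:E)%E /\ (s%:E < (r - w)%:E)%E.
  by apply: ereal_between; rewrite EFinB lteBrDr.
have -> : r *: e = s *: e + (r - s) *: e by rewrite -scalerDl addrC subrK.
apply: preorder_addD; [exact: vf|apply: wg].
by move: sv; rewrite !lte_fin; lra.
Qed.

Lemma cut_meet f g v w : cut f v -> cut g w ->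
  cut (vmeet f g) (Order.min v w).
Proof.
move=> [fv vf] [gw wg]; split => r.
  rewrite lt_min => /andP[rv rw].
  by apply: (lpre_meet QP); [exact: fv|exact: gw].
rewrite gt_min => /orP[/vf|/wg]; apply: (lpre_trans QP); apply: (lpre_le QP).
  exact: vmeetl.
exact: vmeetr.
Qed.

Lemma ext_hom_of_preorder :
  exists x, [/\ ext_hom x, x e = 1%E & forall f g, Q f g -> (x f <= x g)%E].
Proof.
have [x xP] := choice cut_exists; exists x; split.
- split=> [f g|a f|f g xg].
  + exact: cut_unique (xP _) (cut_meet (xP f) (xP g)).
  + exact: cut_unique (xP _) (cutZ a (xP f)).
  + exact: cut_unique (xP _) (cutD xg (xP f) (xP g)).
- exact: cut_unique (xP _) cut_unit.
- by move=> f g; exact: cut_le.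
Qed.

End Cut.

End ExtendedHomomorphisms.

(** * Prime preorders from maximal filters of positive elements *)

Section MeetUltrafilters.
Variables (R : realType) (L : vectorLatticeType R).
Implicit Types (a : R) (u v f g h d : L).

(** The last field is the form in which maximality among proper filters is
    used: a positive element outside the filter is disjoint from a member. *)
Record meet_ultrafilter (U : set L) : Prop := {
  mufilter_ge0 : forall u, U u -> 0 <= u ;
  mufilter_meet : forall u v, U u -> U v -> U (vmeet u v) ;
  mufilter_not0 : ~ U 0 ;
  mufilter_max : forall u, 0 <= u -> ~ U u -> exists2 v, U v & vmeet v u = 0
}.

(** Zorn's lemma is applied to the meet-closed sets whose members are positive
    and not disjoint from [d].  The empty set qualifies, so chains need not be
    assumed nonempty; that [d] is a member follows from maximality. *)
Lemma meet_ultrafilter_exists d : 0 <= d -> d <> 0 ->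
  exists2 U, meet_ultrafilter U & U d.
Proof.
move=> d0 dnz.
pose good (U : set L) := (forall u, U u -> 0 <= u /\ vmeet u d <> 0) /\
  (forall u v, U u -> U v -> U (vmeet u v)).
have [U [[Ud Umeet] Umax]] : exists U, good U /\ forall V, U `<` V -> ~ good V.
  apply: Zorn_bigcup => F Fgood Ftot; split=> [u [V FV Vu]|].
    exact: (Fgood V FV).1 u Vu.
  move=> u v [V FV Vu] [W FW Wv].
  have [VW|WV] := Ftot V W FV FW.
    by exists W => //; apply: (Fgood W FW).2 => //; exact: VW.
  by exists V => //; apply: (Fgood V FV).2 => //; exact: WV.
have Uin (a : L) : 0 <= a -> vmeet a d <> 0 ->
    (forall u, U u -> vmeet (vmeet u a) d <> 0) -> U a.
  move=> a0 ad Ua; apply: contrapT => nUa.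
  (* the filter generated by U and a *)
  pose V := [set c | 0 <= c /\ exists2 w,
    (w = a \/ exists2 u, U u & w = vmeet u a) & w <= c].
  apply: (Umax V).
    split=> [u Uu|]; last first.
      by move=> VU; apply: nUa; apply: VU; split=> //; exists a; [left|].
    split; first exact: (Ud u Uu).1.
    by exists (vmeet u a); [right; exists u|exact: vmeetl].
  split=> [c [c0 [w wP wc]]|b c [b0 [w wP wb]] [c0 [z zP zc]]].
    split=> // cd0.
    have w0 : 0 <= w.
      case: wP => [->//|[u Uu ->]].
      by rewrite vmeet_ge0//; exact: (Ud u Uu).1.
    have wd0 : vmeet w d = 0.
      by apply/eqP; rewrite eq_le vmeet_ge0// andbT -cd0 vmeetS.
    by case: wP wd0 => [->//|[u Uu ->]]; exact: Ua.
  split; first exact: vmeet_ge0.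
  have [y yP [yw yz]] : exists2 y, (y = a \/ exists2 u, U u & y = vmeet u a) &
      y <= w /\ y <= z.
    case: wP zP => [->|[u Uu ->]] [->|[t Ut ->]].
    - by exists a; [left|].
    - by exists (vmeet t a); [right; exists t|rewrite vmeetr].
    - by exists (vmeet u a); [right; exists u|rewrite vmeetr].
    - exists (vmeet (vmeet u t) a).
        by right; exists (vmeet u t) => //; exact: Umeet.
      by rewrite !vmeetS ?vmeetl ?vmeetr.
  by exists y => //; rewrite le_vmeet (le_trans yw wb) (le_trans yz zc).
have dd : vmeet d d = d by rewrite vmeet_l.
have Ud' : U d.
  apply: Uin; rewrite ?dd// => u Uu.
  by rewrite [vmeet (vmeet u d) d]vmeet_l ?vmeetr//; exact: (Ud u Uu).2.
exists U => //; split=> //.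
- by move=> u /Ud[].
- by move=> /Ud[_]; rewrite vmeet_l.
move=> a a0 nUa; apply: contrapT => nU; apply: nUa; apply: Uin => //.
  by move=> ad; apply: nU; exists d => //; rewrite vmeetC.
move=> u Uu uad; apply: nU; exists (vmeet u d); first exact: Umeet.
rewrite -{}uad; apply/eqP.
by rewrite eq_le !le_vmeet !(le_trans (vmeetl _ _) (vmeetl _ _)) ?vmeetr
  !(le_trans (vmeetl _ _) (vmeetr _ _)).
Qed.

Section UltrafilterPreorder.
Variable U : set L.
Hypothesis UP : meet_ultrafilter U.

(** For [u >= 0], membership in the prime ideal complementary to the filter. *)
Definition null_elt u := exists2 v, U v & vmeet v u = 0.

Lemma null_elt_le u v : 0 <= u -> u <= v -> null_elt v -> null_elt u.
Proof.
move=> u0 uv [w Uw wv]; exists w => //; have w0 := mufilter_ge0 UP Uw.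
by apply/eqP; rewrite eq_le vmeet_ge0// andbT -wv vmeetS.
Qed.

Lemma null_eltD u v : 0 <= u -> 0 <= v ->
  null_elt u -> null_elt v -> null_elt (u + v).
Proof.
move=> u0 v0 [w Uw wu] [z Uz zv]; have Uwz := mufilter_meet UP Uw Uz.
have wz0 := mufilter_ge0 UP Uwz.
have uv0 : 0 <= u + v by rewrite -[0]addr0 levD.
exists (vmeet w z) => //; apply/eqP; rewrite eq_le vmeet_ge0// andbT.
rewrite (le_trans (vmeet_leD wz0 u0 v0))// -[leRHS]addr0.
by apply: levD; [rewrite -wu|rewrite -zv]; rewrite vmeetS ?vmeetl ?vmeetr.
Qed.

Lemma null_elt_prime u v : 0 <= u -> 0 <= v -> vmeet u v = 0 ->
  null_elt u \/ null_elt v.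
Proof.
move=> u0 v0 uv; have [Uu|nUu] := pselect (U u); first by right; exists u.
by left; exact: mufilter_max UP _ u0 nUu.
Qed.

Lemma not_null_elt u : U u -> ~ null_elt u.
Proof.
move=> Uu [v Uv vu]; apply: (mufilter_not0 UP); rewrite -vu.
exact: mufilter_meet.
Qed.

Definition null_le f g := null_elt (vpos (f - g)).

Lemma null_eltZ a u : 0 <= a -> 0 <= u -> null_elt u -> null_elt (a *: u).
Proof.
move=> a0 u0 Nu.
have Nn n : null_elt (u *+ n).
  elim: n => [|n IH]; last first.
    by rewrite mulrS; apply: null_eltD; rewrite ?mulrvn_ge0.
  by apply: null_elt_le Nu; rewrite mulr0n.
apply: null_elt_le (Nn (Num.bound a)); first exact: scalev_ge0.
by rewrite -scaler_nat lev_wscale// ltW// archi_boundP.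
Qed.

(** Totality is primeness of the null ideal, as [(f - g)^+] and [(g - f)^+] are
    disjoint. *)
Lemma null_le_preorder : U !=set0 -> lattice_preorder null_le.
Proof.
move=> [u0 Uu0].
have N0 : null_elt 0.
  by exists u0 => //; rewrite vmeetC vmeet_l//; exact: mufilter_ge0 UP _ Uu0.
have Nsub f u v : 0 <= u -> 0 <= v -> null_elt u -> null_elt v ->
    f <= u + v -> null_elt (vpos f).
  move=> u_ge0 v_ge0 Nu Nv fuv.
  apply: null_elt_le (null_eltD u_ge0 v_ge0 Nu Nv); first exact: vpos_ge0.
  by rewrite vpos_leP fuv -[X in X <= _]addr0 levD.
split.
- move=> f g; apply: null_elt_prime; rewrite ?vpos_ge0//.
  by rewrite -[g - f]opprB vposN_disjoint.
- move=> f g h fg gh; apply: Nsub fg gh _; rewrite ?vpos_ge0//.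
  by rewrite (_ : f - h = (f - g) + (g - h)) ?levD ?vpos_ge// addrA subrK.
- move=> f g fg; rewrite /null_le vpos_eq0//.
  by rewrite -[_ <= 0]levN2 oppr0 opprB subv_ge0.
- move=> f g h; rewrite /null_le.
  by rewrite opprD addrACA subrr addr0.
- move=> a f g a0 fg; rewrite /null_le -scalerBr.
  apply: Nsub N0 (null_eltZ a0 (vpos_ge0 _) fg) _;
    rewrite ?scalev_ge0 ?vpos_ge0//.
  by rewrite add0r lev_scale2l// vpos_ge.
- move=> f g h hf hg; apply: Nsub hf hg _; rewrite ?vpos_ge0//.
  rewrite levBlDr [leRHS]addrC -levBlDr le_vmeet !levBlDr.
  apply/andP; split; rewrite [leRHS]addrC -levBlDr.
    by rewrite -[leLHS]addr0 levD ?vpos_ge0 ?vpos_ge.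
  by rewrite -[leLHS]add0r levD ?vpos_ge0 ?vpos_ge.
Qed.

End UltrafilterPreorder.
End MeetUltrafilters.

(** * Points normalized by a truncation *)

Section TruncationPoints.
Variables (R : realType) (L : vectorLatticeType R).
Implicit Types (f g h e : L) (t : L -> L) (x : L -> \bar R).

Definition normalized t x := forall f, 0 <= f -> x (t f) = Order.min 1%E (x f).

Lemma truncation_vmeet e : archimedean_lattice L -> 0 <= e -> e <> 0 ->
  truncation (fun f => vmeet f e).
Proof.
move=> arch e0 enz; split.
- by move=> f f0; exact: vmeet_ge0.
- by exists e; rewrite ?vmeet_l.
- move=> f g f0 g0; split; last exact: vmeetl.
  by apply: vmeetS => //; exact: vmeetr.
- move=> f f0 fe; apply: (arch f e f0 e0) => n n0.
  by rewrite -(fe n n0) vmeetr.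
Qed.

(** Here [e = t kn] is the unit of the quotient by the null elements and
    [kn - e] is the witness, not null, that [t] cuts off: anything disjoint from
    it vanishes in the quotient, which is how [t f] is compared with
    [f /\ e]. *)
Lemma point_exists t h : truncation t -> 0 <= h -> t h <> 0 ->
  exists x, [/\ ext_hom x, normalized t x & (0 < x h)%E].
Proof.
move=> tT h0 thnz; set k := t h; have k0 : 0 <= k := trunc_ge0 tT h0.
have [n [n0 tkn]] : exists n, (0 < n)%N /\ t (k *+ n) <> k *+ n.
  apply: contrapT => H; apply/thnz/(trunc_bounded tT k0) => n n0.
  by apply: contrapT => tkn; apply: H; exists n.
set kn := k *+ n; have kn0 : 0 <= kn by exact: mulrvn_ge0.
have k_le_kn : k <= kn.
  by rewrite /kn -(prednK n0) mulrS -[leLHS]addr0 levD// mulrvn_ge0.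
set e := t kn; have e0 : 0 <= e := trunc_ge0 tT kn0.
have e_le_kn : e <= kn := (trunc_bounds tT kn0 kn0).2.
have k_le_e : k <= e.
  by rewrite -(vmeet_l k_le_kn) vmeetC (trunc_bounds tT kn0 h0).1.
have d0 : 0 <= kn - e by rewrite subv_ge0.
have dnz : kn - e <> 0 by move=> /eqP; rewrite subr_eq0 => /eqP /esym.
have [U UP Ud] := meet_ultrafilter_exists d0 dnz.
have Nd := not_null_elt UP Ud.
have QP : lattice_preorder (null_le U).
  by apply: null_le_preorder => //; exists (kn - e).
have enz : ~ null_le U e 0.
  rewrite /null_le subr0 => Ne; apply: Nd.
  have Nk : null_elt U k.
    by apply: null_elt_le UP _ _ k0 (le_trans k_le_e (vpos_ge e)) Ne.
  have Nkn : null_elt U kn by rewrite /kn -scaler_nat; exact: null_eltZ.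
  by apply: null_elt_le UP _ _ d0 _ Nkn; rewrite levBlDr -[leLHS]addr0 levD.
have [x [xh xe xQ]] := ext_hom_of_preorder QP e0 enz.
exists x; split => // [f f0|].
  have tf0 := trunc_ge0 tT f0.
  have tf_le : x (t f) = x (vmeet f e).
    apply/eqP; rewrite eq_le (ehom_le xh (trunc_bounds tT f0 kn0).1) andbT.
    apply: xQ; rewrite /null_le.
    set a := vpos _; have a0 : 0 <= a by exact: vpos_ge0.
    have ad : vmeet a (kn - e) = 0.
      (* a <= t f - m and kn - e <= kn - m, and these bounds are disjoint *)
      pose m := vmeet (t f) kn.
      have me : m <= e by rewrite /m vmeetC (trunc_bounds tT kn0 f0).1.
      apply/eqP; rewrite eq_le vmeet_ge0// andbT.
      have <- : vmeet (t f - m) (kn - m) = 0 by rewrite -vmeetDr subrr.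
      apply: vmeetS; last by rewrite levD ?levN2.
      rewrite vpos_leP subv_ge0 vmeetl andbT levD// levN2 le_vmeet.
      by rewrite (le_trans (vmeetl _ _) (trunc_bounds tT f0 f0).2).
    by case: (null_elt_prime UP a0 d0 ad).
  by rewrite tf_le (ehom_meet xh) xe minC.
have kh : k <= h := (trunc_bounds tT h0 h0).2.
apply: lt_le_trans (ehom_le xh kh).
(* x k = 0 would give 1 = x e <= x (k *+ n) = 0 *)
rewrite lt_neqAle (ehom_ge0 xh k0) andbT; apply/eqP => xk.
have := ehom_le xh e_le_kn.
by rewrite xe /kn -scaler_nat (ehom_scale xh) -xk mule0 lee_fin ler10.
Qed.

End TruncationPoints.

(** * Evaluation topologies and convergence of extended reals *)

Section EvaluationTopology.
Context {S : choiceType} {I : Type} {Y : topologicalType}.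
Variable ev : I -> S -> Y.

Definition evaluation_topology : topologicalType :=
  sup_topology (fun i => Topological.class (initial_topology (ev i))).

Lemma evaluation_cvgP (G : set_system S) (x : S) : Filter G ->
  G --> (x : evaluation_topology) <-> forall i, ev i @ G --> ev i x.
Proof.
move=> GF; split=> [/cvg_sup Gx i A|Gx].
  rewrite nbhsE => -[B [oB Bx] BA]; apply: (Gx i).
  by rewrite nbhsE; exists (ev i @^-1` B) => [|y /BA//]; split=> //; exists B.
apply/cvg_sup => i A.
rewrite (@nbhsE (initial_topology (ev i))) => -[B [[C oC <-] Cx] BA].
have : (ev i @ G) C by apply: (Gx i); exact: open_nbhs_nbhs.
by rewrite nbhs_filterE; exact: (@filterS _ G).
Qed.

Lemma evaluation_continuous i : continuous (ev i : evaluation_topology -> Y).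
Proof.
move=> x; have /evaluation_cvgP := @cvg_id _ (nbhs (x : evaluation_topology)).
exact.
Qed.

Lemma evaluation_hausdorff : hausdorff_space Y ->
  (forall x y, (forall i, ev i x = ev i y) -> x = y) ->
  hausdorff_space evaluation_topology.
Proof.
move=> Yh inj x y xy; apply: inj => i; apply: Yh => A B Ax By.
have [z [Az Bz]] :=
  xy _ _ (evaluation_continuous Ax) (evaluation_continuous By).
by exists (ev i z).
Qed.

End EvaluationTopology.

Section ExtendedRealConvergence.
Variable R : realType.

Lemma ereal_cvg_cutP (G : set_system (\bar R)) (v : \bar R) : Filter G ->
  (forall r, (r%:E < v)%E -> G [set w | (r%:E < w)%E]) ->
  (forall r, (v < r%:E)%E -> G [set w | (w < r%:E)%E]) -> G --> v.
Proof.
move=> GF below above A; case: v below above => [a| |] below above.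
- move=> [e /= e0 eA].
  have lo : ((a - e)%:E < a%:E)%E by rewrite lte_fin ltrBlDr ltrDl.
  have hi : (a%:E < (a + e)%:E)%E by rewrite lte_fin ltrDl.
  apply: filterS (filterI (below _ lo) (above _ hi)) => -[w| |] [] //=.
  rewrite !lte_fin => w1 w2; apply: eA => /=.
  by rewrite ltr_distlC w1.
- by move=> [M [_ MA]]; apply: filterS (below M (ltry _)) => w; exact: MA.
- by move=> [M [_ MA]]; apply: filterS (above M (ltNyr _)) => w; exact: MA.
Qed.

(** This is compactness of [\bar R]: the limit is the supremum of the values
    that are eventually lower bounds, and an ultrafilter decides each bound. *)
Lemma ereal_ultra_cvg (I : Type) (G : set_system I) (f : I -> \bar R) :
  UltraFilter G -> exists v : \bar R, f @ G --> v.
Proof.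
move=> GU; pose v := ereal_sup [set a | G [set i | (a <= f i)%E]].
exists v; apply: ereal_cvg_cutP => r rv.
  have [a Ga ra] := ereal_sup_gt rv.
  change (G [set i | (r%:E < f i)%E]).
  by apply: filterS Ga => i /= ai; exact: lt_le_trans ra ai.
have [Gr|Gr] := in_ultra_setVsetC [set i | (r%:E <= f i)%E] GU.
  by move: rv; rewrite ltNge ereal_sup_ubound.
change (G [set i | (f i < r%:E)%E]).
by apply: filterS Gr => i /= /negP; rewrite -ltNge.
Qed.

Lemma cvge_min (I : Type) (G : set_system I) {GF : Filter G}
    (f g : I -> \bar R) (a b : \bar R) : f @ G --> a -> g @ G --> b ->
  (fun i => Order.min (f i) (g i)) @ G --> Order.min a b.
Proof.
move=> fa gb.
apply: (@cvg_comp _ _ _ (fun i => (f i, g i))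
  (fun p => Order.min p.1 p.2) _ (nbhs (a, b))).
  exact: cvg_pair fa gb.
exact: (@min_continuous _ (\bar R) (a, b)).
Qed.

End ExtendedRealConvergence.

(** * The spectrum of a disjoint family of truncations *)

Section Spectrum.
Variables (R : realType) (L : vectorLatticeType R) (F : set (L -> L)).
Implicit Types (f g h p q : L) (t : L -> L) (e r s : R).

Definition spectrum_point (x : L -> \bar R) :=
  [/\ ext_hom x, exists2 t, F t & normalized t x & exists f, x f <> 0%E].

Definition spectrum_carrier : choiceType := {classic {x | spectrum_point x}}.

Definition evaluation f (x : spectrum_carrier) : \bar R := sval x f.

Definition spectrum : topologicalType := evaluation_topology evaluation.

Local Notation X := spectrum.
Local Notation T := (evaluation : L -> X -> \bar R).

Lemma evaluation_hom (x : X) : ext_hom (T ^~ x).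
Proof. by case: x => x []. Qed.

Lemma evaluation_normalized (x : X) : exists2 t, F t & normalized t (T ^~ x).
Proof. by case: x => x []. Qed.

Lemma spectrum_hausdorff : hausdorff_space X.
Proof.
apply: evaluation_hausdorff => // -[x xP] [y yP] xy.
by apply: eq_exist; apply/funext.
Qed.

Definition piece t : set X := [set x | normalized t (T ^~ x)].

Hypothesis F_trunc : forall t, F t -> truncation t.
Hypothesis F_disjoint : forall t t', F t -> F t' -> t <> t' ->
  forall f g, 0 <= f -> 0 <= g -> vmeet (t f) (t' g) = 0.
Hypothesis F_total : forall f, 0 <= f -> f <> 0 -> exists2 t, F t & t f <> 0.

Lemma positive_value (x : X) : exists2 f, 0 <= f & (0 < T f x)%E.
Proof.
have xh := evaluation_hom x; have [f xf] : exists f, T f x <> 0%E.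
  by case: (x) => ? [].
have [f0|f0|//] := ltgtP (T f x) 0%E.
  exists (vpos (- f)); first exact: vpos_ge0.
  by rewrite (ehom_pos xh) (ehomN xh) lt_max oppe_gt0 f0.
exists (vpos f); first exact: vpos_ge0.
by rewrite (ehom_pos xh) lt_max f0.
Qed.

Lemma positive_truncation t (x : X) : piece t x ->
  exists2 f, 0 <= f & (0 < T (t f) x)%E.
Proof.
move=> tx; have [f f0 xf] := positive_value x; exists f => //.
by rewrite tx// lt_min lte01 xf.
Qed.

(** On the piece of [t'] some [t' g] is positive, and it is disjoint from
    [t f]. *)
Lemma off_piece t t' (x : X) f : F t -> F t' -> t <> t' -> piece t' x ->
  0 <= f -> T (t f) x = 0%E.
Proof.
move=> Ft Ft' tt' xt' f0; have xh := evaluation_hom x.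
have [g g0 xg] := positive_truncation xt'.
have xtf := ehom_ge0 xh (trunc_ge0 (F_trunc Ft) f0).
apply/eqP; rewrite eq_le xtf andbT leNgt; apply/negP => xtf0.
have := ehom_meet xh (t f) (t' g).
rewrite (F_disjoint Ft Ft')// (ehom0 xh) => /esym/eqP; apply/negP.
by rewrite gt_eqF// lt_min xtf0.
Qed.

Lemma on_piece t (x : X) f : F t -> 0 <= f -> (0 < T (t f) x)%E -> piece t x.
Proof.
move=> Ft f0 xtf; have [t' Ft' xt'] := evaluation_normalized x.
have [->//|/eqP tt'] := eqVneq t t'.
by move: xtf; rewrite (off_piece Ft Ft' tt' xt' f0) ltxx.
Qed.

Lemma piece_inj t t' (x : X) : F t -> F t' -> piece t x -> piece t' x -> t = t'.
Proof.
move=> Ft Ft' xt xt'; apply: contrapT => tt'.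
have [f f0] := positive_truncation xt.
by rewrite (off_piece Ft Ft' tt' xt' f0) ltxx.
Qed.

Lemma open_gt f r : open [set x : X | (r%:E < T f x)%E].
Proof.
apply: (@open_comp _ _ (T f) [set v | (r%:E < v)%E]).
  by move=> x _; exact: evaluation_continuous.
exact: open_ereal_gt_ereal.
Qed.

(** The piece of [t] is the union of the cozero sets of the elements [t f]. *)
Lemma piece_open t : F t -> open (piece t).
Proof.
move=> Ft; rewrite openE => x xt; have [f f0 xf] := positive_truncation xt.
rewrite /interior nbhsE; exists [set y | (0 < T (t f) y)%E].
  by split=> //; exact: open_gt.
by move=> y; exact: on_piece.
Qed.

Lemma piece_closed t : F t -> closed (piece t).
Proof.
move=> Ft; rewrite -openC openE => x nxt.
have [t' Ft' xt'] := evaluation_normalized x.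
rewrite /interior nbhsE; exists (piece t').
  by split=> //; exact: piece_open.
by move=> y yt' yt; apply: nxt; rewrite (piece_inj Ft Ft' yt yt').
Qed.

(** Along an ultrafilter every evaluation converges, and the conditions on a
    point, being closed, hold for the pointwise limit [y].  The bound by [e > 0]
    serves to make [y] nonzero. *)
Lemma piece_compact t f e : F t -> 0 < e ->
  compact [set x : X | piece t x /\ (e%:E <= `|T f x|)%E].
Proof.
move=> Ft e0; rewrite compact_ultra => G GU GK.
have [y Gy] : exists y : L -> \bar R, forall g, T g @ G --> y g.
  have lim g : exists v : \bar R, T g @ G --> v by exact: ereal_ultra_cvg.
  by have [y Gy] := choice lim; exists y.
have uniq (a b : X -> \bar R) (v w : \bar R) : a @ G --> v -> b @ G --> w ->
    (\forall x \near G, a x = b x) -> v = w.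
  move=> av bw ab; have bv : b @ G --> v.
    by apply: cvg_trans av; apply: near_eq_cvg; apply: filterS ab.
  exact: cvg_unique bv bw.
have yh : ext_hom y.
  split=> [g h|a g|g h yh].
  - apply: uniq (Gy (vmeet g h)) (cvge_min (Gy g) (Gy h)) _.
    by apply: filterE => x; exact: ehom_meet (evaluation_hom x) _ _.
  - apply: uniq (Gy (a *: g)) (cvgeZl _ (Gy g)) _ => //.
    by apply: filterE => x; exact: ehom_scale (evaluation_hom x) _ _.
  - apply: uniq (Gy (g + h)) (cvgeD _ (Gy g) (Gy h)) _.
      by rewrite fin_num_adde_defl.
    have : \forall x \near G, T h x \is a fin_num.
      case: (y h) yh (Gy h) => // b _ /fine_cvgP[].
      exact.
    by apply: filterS => x; exact: ehom_add (evaluation_hom x) _ _.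
have yt : normalized t y.
  move=> g g0; apply: uniq (Gy (t g)) (cvge_min (cvg_cst 1%E) (Gy g)) _.
  by apply: filterS GK => x [xt _]; exact: xt.
have ye : (e%:E <= `|y f|)%E.
  apply: (@cvge_to_ge _ G _ R (fun x => `|T f x|%E)); last first.
    by apply: filterS GK => x [].
  by apply: continuous_cvg (Gy f); exact: abse_continuous.
have yP : spectrum_point y.
  split=> //; first by exists t.
  by exists f => yf; move: ye; rewrite yf abse0 lee_fin leNgt e0.
exists (exist _ y yP : X); split=> //.
by apply/evaluation_cvgP => g; exact: Gy.
Qed.

(** Near [x] the element [p] replaces the constant [1], so that constants can be
    subtracted locally although [L] need not contain them; [q] is the cut-off
    that restricts attention to where this is legitimate.  With [h] a multiple
    of [t f] taking the value [2] at [x], take [p = t h] and [q = h - t h]: on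
    the piece of [t] this is [min 1 h] and [(h - 1)^+], and elsewhere both
    vanish. *)
Lemma plateau (x : X) : exists p q, [/\ 0 <= q, T q x = 1%E,
  forall y : X, T q y \is a fin_num
  & forall y : X, (0 < T q y)%E -> T p y = 1%E].
Proof.
have [t Ft xt] := evaluation_normalized x.
have [f f0 xf] := positive_truncation xt.
have tf0 : 0 <= t f := trunc_ge0 (F_trunc Ft) f0.
have tf_fin (y : X) : T (t f) y \is a fin_num.
  have [t' Ft' yt'] := evaluation_normalized y.
  have [tt'|/eqP tt'] := eqVneq t t'; last first.
    by rewrite (off_piece Ft Ft' tt' yt').
  rewrite tt' yt'// ge0_fin_numE ?lt_min ?gt_min ?ltry//.
  by rewrite le_min lee01 (ehom_ge0 (evaluation_hom y)).
pose c := 2 / fine (T (t f) x); pose h := c *: t f.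
have c0 : 0 < c.
  by rewrite divr_gt0// fine_gt0// xf ltey_eq tf_fin.
have h0 : 0 <= h by rewrite scalev_ge0// ltW.
have h_fin (y : X) : T h y \is a fin_num.
  by rewrite (ehom_scale (evaluation_hom y)) fin_numM.
have th_le : t h <= h := (trunc_bounds (F_trunc Ft) h0 h0).2.
have th_fin (y : X) : T (t h) y \is a fin_num.
  have th0 := trunc_ge0 (F_trunc Ft) h0.
  rewrite ge0_fin_numE ?(ehom_ge0 (evaluation_hom y) th0)//.
  apply: le_lt_trans (ehom_le (evaluation_hom y) th_le) _.
  by rewrite ltey_eq h_fin.
have xh2 : T h x = 2%:E.
  rewrite (ehom_scale (evaluation_hom x)) -[X in (_ * X)%E]fineK// -EFinM.
  by rewrite /c divfK// fine_eq0// gt_eqF.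
have qE (y : X) : T (h - t h) y = (T h y - T (t h) y)%E.
  by rewrite (ehomB (evaluation_hom y)).
exists (t h), (h - t h); split.
- by rewrite subv_ge0.
- by rewrite qE xt// xh2 min_l ?lee_fin ?ler1n// -EFinB; congr (_%:E); lra.
- by move=> y; rewrite qE fin_numB h_fin th_fin.
move=> y; have [yt|nyt] := pselect (piece t y); last first.
  have [t' Ft' yt'] := evaluation_normalized y.
  have tt' : t <> t' by move=> tt'; apply: nyt; rewrite tt'.
  rewrite qE (ehom_scale (evaluation_hom y)).
  rewrite (off_piece Ft Ft' tt' yt' f0) mule0.
  by rewrite (off_piece Ft Ft' tt' yt' h0) sube0 ltxx.
rewrite qE yt//; have [//|_] := leP 1%E (T h y).
by rewrite subee ?ltxx.
Qed.

(** The cozero sets of the positive elements below the cut-off [q], positive at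
    [x], generate a filter.  Every evaluation converges along it, because
    [{g > r}] and [{g < r}] contain the cozero sets of [(g - r p)^+ /\ q] and
    [(r p - g)^+ /\ q]; so the filter converges to [x] and refines the
    neighbourhoods of [x]. *)
Lemma separation (x : X) (O : set X) : open O -> O x ->
  exists f, [/\ 0 <= f, T f x = 1%E, forall y : X, T f y \is a fin_num
              & forall y, ~ O y -> T f y = 0%E].
Proof.
move=> oO Ox; have xh := evaluation_hom x.
have [p [q [q0 xq q_fin qp]]] := plateau x.
have xp : T p x = 1%E by apply: qp; rewrite xq lte01.
pose G : set_system X := [set U | exists f,
  [/\ 0 <= f, f <= q, (0 < T f x)%E & [set y : X | (0 < T f y)%E] `<=` U]].
have GF : Filter G.
  split=> [|U V [f [f0 fq xf fU]] [g [g0 gq xg gV]]|U V UV [f [f0 fq xf fU]]].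
  - by exists q; rewrite xq lte01.
  - exists (vmeet f g); split; first exact: vmeet_ge0.
    + exact: le_trans (vmeetl f g) fq.
    + by rewrite (ehom_meet xh) lt_min xf.
    + move=> y /=; rewrite (ehom_meet (evaluation_hom y)) lt_min.
      move=> /andP[yf yg].
      by split; [exact: fU|exact: gV].
  - by exists f; split=> // y /fU /UV.
have cutoff g : (0 < T g x)%E ->
    G [set y : X | T p y = 1%E /\ (0 < T g y)%E].
  move=> xg; exists (vmeet (vpos g) q); split.
  - by rewrite vmeet_ge0 ?vpos_ge0.
  - exact: vmeetr.
  - by rewrite (ehom_meet xh) (ehom_pos xh) lt_min lt_max xg xq lte01.
  - move=> y /=; have yh := evaluation_hom y.
    rewrite (ehom_meet yh) (ehom_pos yh) lt_min lt_max ltxx orbF.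
    move=> /andP[yg yq].
    by split=> //; exact: qp.
have shift (y : X) g r : T p y = 1%E -> T (g - r *: p) y = (T g y - r%:E)%E.
  move=> yp; have yrp : T (r *: p) y = r%:E.
    by rewrite (ehom_scale (evaluation_hom y)) yp mule1.
  by rewrite (ehomB (evaluation_hom y)) yrp.
have Gx : G --> x.
  apply/evaluation_cvgP => g; apply: ereal_cvg_cutP => r rg.
    change (G [set y : X | (r%:E < T g y)%E]).
    have : (0 < T (g - r *: p)%R x)%E by rewrite shift// sube_gt0.
    by move=> /cutoff; apply: filterS => y [yp]; rewrite shift// sube_gt0.
  change (G [set y : X | (T g y < r%:E)%E]).
  have opp (y : X) : T p y = 1%E -> T (r *: p - g) y = (r%:E - T g y)%E.
    move=> yp; rewrite -opprB (ehomN (evaluation_hom y)) shift//.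
    by rewrite fin_num_oppeB// addeC.
  have : (0 < T (r *: p - g)%R x)%E by rewrite opp// sube_gt0.
  by move=> /cutoff; apply: filterS => y [yp]; rewrite opp// sube_gt0.
have [f [f0 fq xf fO]] : G O by apply: Gx; exact: open_nbhs_nbhs.
have f_fin (y : X) : T f y \is a fin_num.
  have yh := evaluation_hom y.
  rewrite ge0_fin_numE ?(ehom_ge0 yh f0)// (le_lt_trans (ehom_le yh fq))//.
  by rewrite ltey_eq q_fin.
have c0 : 0 < fine (T f x) by rewrite fine_gt0// xf ltey_eq f_fin.
exists ((fine (T f x))^-1 *: f); split.
- by rewrite scalev_ge0// invr_ge0 ltW.
- rewrite (ehom_scale xh) -[X in (_ * X)%E]fineK// -EFinM mulVf//.
  by rewrite gt_eqF.
- by move=> y; rewrite (ehom_scale (evaluation_hom y)) fin_numM.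
- move=> y nOy; have yh := evaluation_hom y.
  rewrite (ehom_scale yh) (_ : T f y = 0%E) ?mule0//.
  apply/eqP; rewrite eq_le (ehom_ge0 yh f0) andbT leNgt; apply/negP.
  by move=> /fO.
Qed.

Lemma spectrum_faithful f : 0 <= f -> (forall x : X, T f x = 0%E) -> f = 0.
Proof.
move=> f0 f_eq0; apply: contrapT => /(F_total f0)[t Ft tf].
have [x [xh xt xf]] := point_exists (F_trunc Ft) f0 tf.
have xP : spectrum_point x.
  by split=> //; [exists t|exists f => xf0; move: xf; rewrite xf0 ltxx].
by have := f_eq0 (exist _ x xP); move: xf => /[swap] /= ->; rewrite ltxx.
Qed.

Hypothesis L_arch : archimedean_lattice L.

(** If [|f|] were infinite on [O], an [h] equal to [1] somewhere and to [0] off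
    [O] would have all its multiples below [|f|] pointwise, hence in [L] by
    [spectrum_faithful]. *)
Lemma finite_dense f : dense [set x : X | `|T f x|%E != +oo%E].
Proof.
move=> O [x Ox] oO; apply: contrapT => Of.
have [h [h0 xh h_fin hO]] := separation oO Ox.
suff h_eq0 : h = 0.
  move: xh; rewrite h_eq0 (ehom0 (evaluation_hom x)) => -[] /eqP.
  by rewrite eq_sym oner_eq0.
pose af := vjoin f (- f).
have afE (y : X) : T af y = `|T f y|%E.
  have yh := evaluation_hom y; rewrite (ehom_join yh) (ehomN yh).
  have [f0|f0] := leP 0%E (T f y).
    rewrite gee0_abs// max_l//.
    by apply: (@le_trans _ _ 0%E) => //; rewrite oppe_le0.
  rewrite lte0_abs// max_r//.
  by apply: (le_trans (ltW f0)); rewrite oppe_ge0 ltW.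
have af0 : 0 <= af.
  have := spectrum_faithful (vpos_ge0 (- af)); move=> /(_ _)/wrap[y|af0].
    have yh := evaluation_hom y.
    by rewrite (ehom_pos yh) (ehomN yh) afE max_r// oppe_le0.
  by rewrite -levN2 oppr0 -af0 vpos_ge.
apply: (L_arch h0 af0) => n n0.
rewrite -subv_ge0 -levN2 oppr0 opprB.
suff <- : vpos (h *+ n - af) = 0 by exact: vpos_ge.
apply: spectrum_faithful => [|y]; first exact: vpos_ge0.
have yh := evaluation_hom y; rewrite (ehom_pos yh); apply/max_idPr.
have hnE : T (h *+ n) y = (n%:R%:E * T h y)%E.
  by rewrite -scaler_nat (ehom_scale yh).
have hn_fin : T (h *+ n) y \is a fin_num by rewrite hnE fin_numM.
rewrite -opprB (ehomN yh) (ehomB yh)// oppe_le0 afE.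
have [Oy|nOy] := pselect (O y); last by rewrite hnE hO// mule0 sube0.
have -> : `|T f y|%E = +oo%E.
  by apply: contrapT => /eqP fy; apply: Of; exists y.
rewrite -(fineK hn_fin). exact: leey.
Qed.

Lemma evaluation_Cinfty f : Cinfty (T f).
Proof. by split; [exact: evaluation_continuous|exact: finite_dense]. Qed.

(** Pointwise equality does not at once give [T (f - g) = 0], because of
    infinite values; for [u <= v] the open set where [v - u] is positive would
    contain a point at which [u] is finite. *)
Lemma evaluation_inj f g : T f = T g -> f = g.
Proof.
suff le_inj u v : T u = T v -> u <= v -> u = v.
  move=> fg; have fgE : vmeet f g = f.
    apply: le_inj; last exact: vmeetl.
    apply/funext => y; rewrite (ehom_meet (evaluation_hom y)).
    by rewrite -[evaluation g y]/(T g y) -fg minxx.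
  have gfE : vmeet f g = g.
    apply: le_inj; last exact: vmeetr.
    by rewrite fgE.
  by rewrite -fgE gfE.
move=> uv le_uv; apply/eqP; rewrite eq_sym -subr_eq0; apply/eqP.
have d0 : 0 <= v - u by rewrite subv_ge0.
apply: spectrum_faithful => // x; apply/eqP.
rewrite eq_le (ehom_ge0 (evaluation_hom x) d0) andbT leNgt; apply/negP => xd.
have [|//|y [yd yu]] :=
  finite_dense u (O := [set y : X | (0 < T (v - u)%R y)%E]).
- by exists x.
- exact: open_gt.
have yu_fin : T u y \is a fin_num by rewrite fin_num_abs ltey.
move: yd; rewrite /= (ehomB (evaluation_hom y))// -[evaluation v y]/(T v y) -uv.
by rewrite subee ?ltxx.
Qed.

Lemma spectrum_locally_compact : locally_compact [set: X].
Proof.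
move=> x _; have [t Ft xt] := evaluation_normalized x.
have [h [_ xh _ _]] := separation (piece_open Ft) xt.
have half0 : 0 < 2^-1 :> R by rewrite invr_gt0.
exists [set y : X | piece t y /\ ((2^-1 : R)%:E <= `|T h y|)%E].
  have tx : nbhs x (piece t).
    by apply: open_nbhs_nbhs; split=> //; exact: piece_open.
  have hx : nbhs x [set y : X | ((2^-1 : R)%:E < T h y)%E].
    apply: open_nbhs_nbhs; split; first exact: open_gt.
    by rewrite /= xh lte_fin invf_lt1// ltr1n.
  apply: filterS (filterI tx hx) => y [yt yh] _; split=> //.
  by rewrite (le_trans (ltW yh))// lee_abs.
have K := piece_compact (f := h) Ft half0; split=> //.
exact: compact_closed spectrum_hausdorff K.
Qed.

End Spectrum.

(** * Maximal disjoint families of truncations *)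

Section TruncationFamily.
Variables (R : realType) (L : vectorLatticeType R) (star : L -> L).
Hypotheses (L_arch : archimedean_lattice L) (star_trunc : truncation star).

Lemma truncation_family_exists : exists F : set (L -> L), [/\ F star,
  forall t, F t -> truncation t,
  forall t t', F t -> F t' -> t <> t' ->
    forall f g : L, 0 <= f -> 0 <= g -> vmeet (t f) (t' g) = 0
  & forall f : L, 0 <= f -> f <> 0 -> exists2 t, F t & t f <> 0].
Proof.
(* star is kept out of the sets ordered by inclusion, so that the union of the
   empty chain qualifies *)
pose disj (t t' : L -> L) :=
  forall f g : L, 0 <= f -> 0 <= g -> vmeet (t f) (t' g) = 0.
pose good (F : set (L -> L)) := (forall t, F t -> truncation t) /\
  forall t t', (star |` F) t -> (star |` F) t' -> t <> t' -> disj t t'.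
have [F [[FT Fdisj] Fmax]] : exists F, good F /\ forall G, F `<` G -> ~ good G.
  apply: Zorn_bigcup => C Cgood Ctot; split=> [t [F CF Ft]|t t' Ft Ft' tt'].
    exact: (Cgood F CF).1 t Ft.
  have [F [[CF|F0] tF t'F]] : exists F,
      [/\ C F \/ F = set0, (star |` F) t & (star |` F) t'].
    case: Ft Ft' => [->|[F CF Ft]] [->|[G CG Gt]].
    - by exists set0; split; [right|left|left].
    - by exists G; split; [left|left|right].
    - by exists F; split; [left|right|left].
    - have [FG|GF] := Ctot F G CF CG.
        by exists G; split; [left|right; exact: FG|right].
      by exists F; split; [left|right|right; exact: GF].
  - exact: (Cgood F CF).2.
  - by move: tF t'F tt'; rewrite F0 setU0 => -> -> /(_ erefl).
exists (star |` F); split=> //; first by left.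
- by move=> t [->//|]; exact: FT.
move=> f f0 fnz; apply: contrapT => H.
have tf0 t : (star |` F) t -> t f = 0.
  by move=> Ft; apply: contrapT => tf; apply: H; exists t.
pose t := fun g : L => vmeet g f.
have tT : truncation t by exact: truncation_vmeet.
have tdisj t' : (star |` F) t' -> disj t' t /\ disj t t'.
  move=> Ft'; have t'T : truncation t' by case: Ft' => [->//|]; exact: FT.
  have d g h : 0 <= g -> 0 <= h -> vmeet (t' g) (t h) = 0.
    move=> g0 h0; apply/eqP; rewrite eq_le vmeet_ge0 ?(trunc_ge0 t'T)//.
      rewrite andbT -(tf0 _ Ft') vmeetC.
      apply: le_trans (trunc_bounds t'T f0 g0).1.
      by apply: vmeetS => //; exact: vmeetr.
    exact: vmeet_ge0.
  by split=> g h g0 h0; [exact: d|rewrite vmeetC d].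
apply: (Fmax (t |` F)).
  split; first by move=> t' Ft'; right.
  move=> FF; have Ft : F t by apply: FF; left.
  by apply: fnz; rewrite -{1}(vmeet_l (lexx f)); apply: (tf0 t); right.
split=> [t' [->//|]|t1 t2]; first exact: FT.
have split_t t' : (star |` (t |` F)) t' -> t' = t \/ (star |` F) t'.
  by case=> [->|[->|Ft']]; [right; left|left|right; right].
move=> /split_t[->|F1] /split_t[->|F2]//.
- by move=> _; exact: (tdisj t2 F2).2.
- by move=> _; exact: (tdisj t1 F1).1.
- exact: Fdisj.
Qed.

End TruncationFamily.

(** * The representation theorem *)

Theorem theorem5p4 (R : realType) (L : vectorLatticeType R) (star : L -> L)
    (L_arch : archimedean_lattice L) (star_trunc : truncation star) :
  exists (X : topologicalType) (A : set (X -> \bar R)) (T : L -> X -> \bar R),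
    [/\ locally_compact [set: X], hausdorff_space X
      & vector_lattice_isomorphism T A] /\
    vector_sublattice A /\
    separates_points_from_closed_sets A /\
    vanishes_nowhere A /\
    exists Y : set X,
      [/\ open Y /\ closed Y,
          forall f : L, 0 <= f ->
            T (star f) = Cinfty_meet (fun x => (\1_Y x)%:E) (T f)
        & forall (f : L) (e : R), 0 < e ->
            compact [set y | Y y /\ (e%:E <= `|T f y|)%E]].
Proof.
have [F [Fstar FT Fdisj Ftot]] := truncation_family_exists L_arch star_trunc.
pose X := spectrum F; pose T := @evaluation _ L F : L -> X -> \bar R.
have hom (x : X) : ext_hom (T ^~ x) := evaluation_hom x.
have T_meet f g : T (vmeet f g) = Cinfty_meet (T f) (T g).
  by apply/funext => x; exact: ehom_meet (hom x) f g.
have T_join f g : T (vjoin f g) = Cinfty_join (T f) (T g).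
  by apply/funext => x; exact: ehom_join (hom x) f g.
have T_sum f g : Cinfty_sum (T f) (T g) (T (f + g)).
  by move=> x _ xg; exact: ehom_add (hom x) f g xg.
have T_scale a f : T (a *: f) = Cinfty_scale a (T f).
  by apply/funext => x; exact: ehom_scale (hom x) a f.
exists X, (range T), T; split.
  split; [exact: spectrum_locally_compact|exact: spectrum_hausdorff|split=> //].
  split=> [f _|f g _ _|_ [f _ <-]]; [by exists f| |by exists f].
  exact: evaluation_inj.
split.
  split=> [_ [f _ <-]|_ _ [f _ <-] [g _ <-]|_ _ [f _ <-] [g _ <-]
          |_ _ [f _ <-] [g _ <-]|a _ [f _ <-]].
  - exact: evaluation_Cinfty.
  - by exists (vmeet f g).
  - by exists (vjoin f g).
  - by exists (T (f + g)) => //; exists (f + g).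
  - by exists (a *: f).
split.
  move=> C x cC nCx.
  have [f [f0 xf _ fC]] := separation FT Fdisj (closed_openC cC) nCx.
  exists (T f); split=> //.
    by move=> y; have := ehom_ge0 (hom y) f0.
  by move=> y Cy; apply: fC => /(_ Cy).
split.
  move=> x; have [f f0 xf] := positive_value x.
  exists (T f); first by exists f.
  by move=> xf0; move: xf; rewrite -[evaluation f x]/(T f x) xf0 ltxx.
exists (piece star); split=> [|f f0|f e e0].
- by split; [exact: piece_open|exact: piece_closed].
- apply/funext => x; rewrite /Cinfty_meet indicE.
  have [xY|nxY] := pselect (piece star x).
    by rewrite mem_set//; exact: xY.
  rewrite memNset// min_l; last by have := ehom_ge0 (hom x) f0.
  have [t Ft xt] := evaluation_normalized x.
  have st : star <> t by move=> st; apply: nxY; rewrite st.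
  by have := off_piece FT Fdisj Fstar Ft st xt f0.
- exact: piece_compact.
Qed.
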